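(* Let $R$ be a finite Frobenius ring and $K$ a field whose characteristic does not divide that of $R$. Then $KR$ is a Frobenius algebra, where $KR$ denotes the monoid algebra over $K$ of the multiplicative monoid of $R$.
   Context: A finite unital (not necessarily commutative) ring $R$ is Frobenius if it is self-injective and $R/J(R)$ is isomorphic to the left socle of $R$ as a left $R$-module, where $J(R)$ is the Jacobson radical. The monoid algebra $KR$ has $K$-basis the set $R$, with product extending the multiplication of $R$ $K$-bilinearly (the addition of $R$ is not used; the zero of $R$ is a nonzero basis element of $KR$). A finite dimensional unital $K$-algebra $A$ is a Frobenius algebra if there is a $K$-linear map $\lambda\colon A\to K$ such that the bilinear form $(a,b)\mapsto\lambda(ab)$ is nondegenerate. Characteristic $0$ does not divide the (positive) characteristic of a finite ring. *)

(* Defs.v *)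
From HB Require Import structures.
From mathcomp Require Import all_boot all_order all_algebra all_fingroup all_field.

Set Implicit Arguments.
Unset Strict Implicit.
Unset Printing Implicit Defensive.

Import GRing.Theory.
Local Open Scope ring_scope.

Section Submodules.
Variables (R : pzRingType) (V : lmodType R) (S : submodClosed V).

Record submodule : Type := Submodule {
  submodule_val :> V;
  submodule_mem : submodule_val \in S
}.

HB.instance Definition _ := [isSub for submodule_val].
HB.instance Definition _ := [Choice of submodule by <:].
HB.instance Definition _ := [SubChoice_isSubLmodule of submodule by <:].

Definition submod_pred : {pred V} := [pred x | x \in S].

Fact submod_pred_zmod_closed : zmod_closed submod_pred.
Proof. exact: GRing.submod_closedB (GRing.submodClosedP S). Qed.

HB.instance Definition _ :=
  GRing.isZmodClosed.Build V submod_pred submod_pred_zmod_closed.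

(* The library gives the quotient Quotient.quot only an additive structure. *)
Definition quot_module : Type := Quotient.quot submod_pred.

HB.instance Definition _ := GRing.Zmodule.on quot_module.

Definition quot_pi (x : V) : quot_module := \pi_(Quotient.quot submod_pred)%qT x.

Definition quot_scale (a : R) (q : quot_module) : quot_module :=
  quot_pi (a *: generic_quotient.repr (q : Quotient.quot submod_pred)).

Lemma quot_pi_eq x y : (quot_pi x == quot_pi y) = (x - y \in S).
Proof. exact: esym (Quotient.idealrBE submod_pred x y). Qed.

Lemma quot_pi_surj q : quot_pi (generic_quotient.repr (q : Quotient.quot submod_pred)) = q.
Proof. exact: reprK. Qed.

Lemma quot_piD : {morph quot_pi : x y / x + y}.
Proof. by move=> x y; apply: (@Quotient.pi_add _ submod_pred). Qed.

Lemma quot_scale_pi a x : quot_scale a (quot_pi x) = quot_pi (a *: x).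
Proof.
apply/eqP; rewrite quot_pi_eq -scalerBr rpredZ //.
by rewrite -quot_pi_eq quot_pi_surj.
Qed.

Fact quot_scaleA a b q :
  quot_scale a (quot_scale b q) = quot_scale (a * b) q.
Proof. by rewrite -[q]quot_pi_surj !quot_scale_pi scalerA. Qed.

Fact quot_scale1 : left_id 1 quot_scale.
Proof. by move=> q; rewrite -[q]quot_pi_surj quot_scale_pi scale1r. Qed.

Fact quot_scaleDr : right_distributive quot_scale +%R.
Proof.
move=> a p q; rewrite -[p]quot_pi_surj -[q]quot_pi_surj.
by rewrite -quot_piD !quot_scale_pi -quot_piD scalerDr.
Qed.

Fact quot_scaleDl q : {morph quot_scale^~ q : a b / a + b}.
Proof.
move=> a b; rewrite -[q]quot_pi_surj.
by rewrite !quot_scale_pi -quot_piD scalerDl.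
Qed.

HB.instance Definition _ :=
  GRing.Zmodule_isLmodule.Build R quot_module
    quot_scaleA quot_scale1 quot_scaleDr quot_scaleDl.

End Submodules.

Definition lmod_isomorphic (R : pzRingType) (M N : lmodType R) : Prop :=
  exists f : {linear M -> N}, bijective f.

Definition injective_module (R : pzRingType) (E : lmodType R) : Prop :=
  forall (M N : lmodType R) (i : {linear M -> N}) (f : {linear M -> E}),
    injective i -> exists g : {linear N -> E}, forall x, g (i x) = f x.

Section FiniteRing.
Variable R : finPzRingType.
Implicit Types I : {set R}.

Definition left_ideal I : bool :=
  (0 \in I) &&
  [forall a : R, forall x in I, forall y in I, a * x + y \in I].

Lemma left_idealP I :
  reflect (submod_closed ([pred x | x \in I] : {pred R^o})) (left_ideal I).
Proof.
apply: (iffP andP) => [[I0 Ilin] | [I0 Ilin]]; split=> //.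
  move=> a x y Ix Iy.
  by have /forallP/(_ a)/forall_inP/(_ x Ix)/forall_inP/(_ y Iy) := Ilin.
apply/forallP=> a; apply/forall_inP=> x Ix; apply/forall_inP=> y Iy.
exact: Ilin.
Qed.

Definition maximal_left_ideal I : bool :=
  maxset [pred L : {set R} | left_ideal L && (L != [set: R])] I.

Definition minimal_left_ideal I : bool :=
  minset [pred L : {set R} | left_ideal L && (L != [set 0])] I.

Definition jacobson_radical : {pred R^o} :=
  [pred x | [forall (I | maximal_left_ideal I), x \in I]].

(* The sum of all the minimal left ideals. *)
Definition left_socle : {pred R^o} :=
  [pred x | [exists f : {ffun {set R} -> R},
     [forall (I | minimal_left_ideal I), f I \in I]
     && (x == \sum_(I | minimal_left_ideal I) f I)]].

Fact jacobson_radical_submod_closed : submod_closed jacobson_radical.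
Proof.
split=> [|a x y Jx Jy]; apply/forall_inP=> I maxI.
  by have /maxsetp/andP[/left_idealP[]] := maxI.
have /maxsetp/andP[/left_idealP[_ Ilin] _] := maxI.
by apply: Ilin; [apply: (forall_inP Jx) | apply: (forall_inP Jy)].
Qed.

Fact left_socle_submod_closed : submod_closed left_socle.
Proof.
split=> [|a x y].
  apply/existsP; exists [ffun=> 0]; rewrite big1 => [|I _]; last by rewrite ffunE.
  rewrite eqxx andbT; apply/forall_inP=> I minI; rewrite ffunE.
  by have /minsetp/andP[/left_idealP[]] := minI.
case/existsP=> f /andP[/forall_inP fI /eqP->].
case/existsP=> g /andP[/forall_inP gI /eqP->].
apply/existsP; exists [ffun I => a * f I + g I]; apply/andP; split.
  apply/forall_inP=> I minI; rewrite ffunE.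
  have /minsetp/andP[/left_idealP[_ Ilin] _] := minI.
  by apply: Ilin; [apply: fI | apply: gI].
under [X in _ == X]eq_bigr => I _ do rewrite ffunE.
by rewrite big_split -mulr_sumr.
Qed.

HB.instance Definition _ := GRing.isSubmodClosed.Build R R^o
  jacobson_radical (GRing.submod_closed_semi jacobson_radical_submod_closed).
HB.instance Definition _ := GRing.isSubmodClosed.Build R R^o
  left_socle (GRing.submod_closed_semi left_socle_submod_closed).

(* R^o is R as a left module; over a finite ring, left and right
   self-injectivity are equivalent. *)
Definition frobenius_ring : Prop :=
  injective_module R^o
  /\ lmod_isomorphic (quot_module jacobson_radical) (submodule left_socle).

(* The order of 1 in the additive group of R, a positive number. *)
Definition ring_characteristic : nat := #[(1%R : (R : finZmodType))]%g.

End FiniteRing.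

(* The monoid algebra of a finite monoid, given by its carrier M and its law
   op; an element is the family of its coordinates in the basis M.  The type
   mentions op so that instances can be attached to it. *)
Definition monoid_algebra (K : fieldType) (M : finType) (e : M)
  (op : Monoid.law e) : Type := {ffun M -> K^o}.

Section MonoidAlgebra.
Variables (K : fieldType) (M : finType) (e : M) (op : Monoid.law e).

Local Notation monoid_algebra := (monoid_algebra K op).

HB.instance Definition _ := Vector.on monoid_algebra.

Implicit Types u v w : monoid_algebra.

Definition monoid_basis (m : M) : monoid_algebra :=
  [ffun x => (x == m)%:R].

Definition monoid_algebra_mul u v : monoid_algebra :=
  \sum_(m : M) \sum_(n : M) (u m * v n) *: monoid_basis (op m n).

Lemma monoid_algebra_decomp u : u = \sum_(m : M) u m *: monoid_basis m.
Proof.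
apply/ffunP=> x; rewrite sum_ffunE (bigD1 x) //= big1 => [|m neq_mx].
  by rewrite addr0 !ffunE eqxx [_ *: _]mulr1.
by rewrite !ffunE eq_sym (negPf neq_mx) [_ *: _]mulr0.
Qed.

Local Notation mul := monoid_algebra_mul.

Fact monoid_algebra_mulDl : left_distributive mul +%R.
Proof.
move=> u v w; rewrite /mul -big_split; apply: eq_bigr => m _.
by rewrite -big_split; apply: eq_bigr => n _; rewrite ffunE mulrDl scalerDl.
Qed.

Fact monoid_algebra_mulDr : right_distributive mul +%R.
Proof.
move=> u v w; rewrite /mul -big_split; apply: eq_bigr => m _.
by rewrite -big_split; apply: eq_bigr => n _; rewrite ffunE mulrDr scalerDl.
Qed.

Fact monoid_algebra_scaleAl a u v : a *: mul u v = mul (a *: u) v.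
Proof.
rewrite /mul scaler_sumr; apply: eq_bigr => m _.
rewrite scaler_sumr; apply: eq_bigr => n _.
by rewrite ffunE scalerA mulrA.
Qed.

Fact monoid_algebra_scaleAr a u v : a *: mul u v = mul u (a *: v).
Proof.
rewrite /mul scaler_sumr; apply: eq_bigr => m _.
rewrite scaler_sumr; apply: eq_bigr => n _.
by rewrite ffunE scalerA mulrCA.
Qed.

Lemma monoid_basis_mul m n :
  mul (monoid_basis m) (monoid_basis n) = monoid_basis (op m n).
Proof.
rewrite /mul (bigD1 m) //= [X in _ + X]big1 => [|x neq_xm].
  rewrite addr0 (bigD1 n) //= big1 => [|y neq_yn].
    by rewrite addr0 !ffunE !eqxx mulr1 scale1r.
  by rewrite !ffunE (negPf neq_yn) mulr0 scale0r.
by rewrite big1 // => y _; rewrite !ffunE (negPf neq_xm) mul0r scale0r.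
Qed.

Fact monoid_algebra_mul_suml I (r : seq I) (F : I -> monoid_algebra) v :
  mul (\sum_(i <- r) F i) v = \sum_(i <- r) mul (F i) v.
Proof.
apply: (big_morph (mul^~ v)) => [x y|]; first exact: monoid_algebra_mulDl.
by rewrite -[LHS](addKr (mul 0 v)) -monoid_algebra_mulDl addr0 addNr.
Qed.

Fact monoid_algebra_mul_sumr I (r : seq I) (F : I -> monoid_algebra) u :
  mul u (\sum_(i <- r) F i) = \sum_(i <- r) mul u (F i).
Proof.
apply: (big_morph (mul u)) => [x y|]; first exact: monoid_algebra_mulDr.
by rewrite -[LHS](addKr (mul u 0)) -monoid_algebra_mulDr addr0 addNr.
Qed.

Fact monoid_algebra_mulA : associative mul.
Proof.
have := (monoid_algebra_scaleAl, monoid_algebra_scaleAr, monoid_basis_mul).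
move: monoid_algebra_mul_suml monoid_algebra_mul_sumr.
move: mul => f suml sumr [[scaleAl scaleAr] basis_mul] u v w.
rewrite (monoid_algebra_decomp u) !suml.
apply: eq_bigr => m _; rewrite -!scaleAl; congr (_ *: _).
rewrite (monoid_algebra_decomp v) suml !sumr suml.
apply: eq_bigr => n _; rewrite -scaleAl -!scaleAr -scaleAl; congr (_ *: _).
rewrite (monoid_algebra_decomp w) !sumr.
apply: eq_bigr => p _; rewrite -!scaleAr; congr (_ *: _).
by rewrite !basis_mul Monoid.mulmA.
Qed.

Fact monoid_algebra_mul1 : left_id (monoid_basis e) mul.
Proof.
have := (monoid_algebra_mul_sumr, monoid_algebra_scaleAr, monoid_basis_mul).
move: mul => f [[sumr scaleAr] basis_mul] u.
rewrite [in RHS](monoid_algebra_decomp u) [in LHS](monoid_algebra_decomp u) sumr.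
by apply: eq_bigr => m _; rewrite -scaleAr basis_mul Monoid.mul1m.
Qed.

Fact monoid_algebra_mulr1 : right_id (monoid_basis e) mul.
Proof.
have := (monoid_algebra_mul_suml, monoid_algebra_scaleAl, monoid_basis_mul).
move: mul => f [[suml scaleAl] basis_mul] u.
rewrite [in RHS](monoid_algebra_decomp u) [in LHS](monoid_algebra_decomp u).
by rewrite suml; apply: eq_bigr => m _; rewrite -scaleAl basis_mul Monoid.mulm1.
Qed.

Fact monoid_algebra_1neq0 : monoid_basis e != 0.
Proof.
apply/eqP=> /ffunP/(_ e)/eqP.
by rewrite !ffunE eqxx oner_eq0.
Qed.

HB.instance Definition _ := GRing.Zmodule_isNzRing.Build monoid_algebra
  monoid_algebra_mulA monoid_algebra_mul1 monoid_algebra_mulr1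
  monoid_algebra_mulDl monoid_algebra_mulDr monoid_algebra_1neq0.
HB.instance Definition _ := GRing.Lmodule_isLalgebra.Build K monoid_algebra
  monoid_algebra_scaleAl.
HB.instance Definition _ := GRing.Lalgebra_isAlgebra.Build K monoid_algebra
  monoid_algebra_scaleAr.
HB.instance Definition _ := Algebra_isFalgebra.Build K monoid_algebra.

End MonoidAlgebra.

Section FrobeniusAlgebra.
Variables (K : fieldType) (A : falgType K).

Definition nondegenerate_form (B : A -> A -> K) : Prop :=
  (forall a, (forall b, B a b = 0) -> a = 0)
  /\ (forall b, (forall a, B a b = 0) -> b = 0).

Definition frobenius_algebra : Prop :=
  exists lambda : {scalar A}, nondegenerate_form (fun a b => lambda (a * b)).

End FrobeniusAlgebra.

(* Main.v *)
(** The left socle of R is cyclic, being isomorphic to R/J(R).  For c in the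
    socle and Rx simple, induction on a decomposition of Rc into simple modules
    gives #|Hom(Rx, Rc)| <= #|Hom(Rc, Rx)|.  A morphism Rc -> Rx is determined
    by the image of c, and x is not such an image when c + x generates a direct
    sum of Rc and Rx, so then #|Hom(Rx, Rc)| < #|Rx|.  Suppose that psi is an
    additive character with no nonzero left ideal of Rc in its kernel.  A
    character of Rx fails to extend this property to Rc + Rx only if it is
    psi \o h for some h in Hom(Rx, Rc), and Rx has #|Rx| characters, so that
    some character works.  Hence R has an additive character psi whose kernel
    contains no nonzero left ideal.

    Write psi = w ^+ phi with w a primitive root of unity of order n, the
    characteristic of R.  Over a field K containing such a root, r |-> w ^ phi r
    would be a Frobenius functional, by invertibility of the character table
    of (R, +).  To avoid the root, t |-> w ^ t is replaced by a function l from
    Z/n to K for which the matrix l (k * t) is invertible.  If an element of KR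
    pairs to zero with all the functions r |-> l (phi (s * r)), then its sums
    over the fibers of all the maps r |-> phi (s * r) vanish, and these sums
    determine it because #|R| is invertible in K. *)

Require Import Defs.
From HB Require Import structures.
From mathcomp Require Import all_boot all_order all_algebra all_fingroup all_field.
From mathcomp Require Import all_solvable all_character.

Set Implicit Arguments.
Unset Strict Implicit.
Unset Printing Implicit Defensive.

Import GRing.Theory.
Local Open Scope ring_scope.

(** * Nondegenerate functions on Z/n *)

Section ResidueForms.
Variable K : fieldType.
Implicit Types (l b : nat -> K) (n k t u : nat).

(** Stands in for [t |-> w ^ t] with [w] a primitive [n]-th root of unity, for which the matrix is
    the character table of Z/n. Functions on Z/n are periodic functions on [nat], so that the
    modulus can vary. *)
Definition nondegenerate_mod n l :=
  (forall t, l (t %% n)%N = l t) /\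
  (forall b, (forall k, \sum_(t < n) b t * l (k * t)%N = 0) ->
     forall t, (t < n)%N -> b t = 0).

Lemma sum_residues n m b l : (0 < m)%N -> (forall t, l (t %% m)%N = l t) ->
  \sum_(t < n) b t * l t =
  \sum_(u < m) (\sum_(t < n | (t %% m)%N == u) b t) * l u.
Proof.
move=> m0 lm.
rewrite (partition_big (fun t : 'I_n => Ordinal (ltn_pmod t m0)) xpredT) //=.
apply: eq_bigr => u _; rewrite mulr_suml; apply: eq_big => [t|t /eqP <-].
  by rewrite -val_eqE.
by rewrite /= lm.
Qed.

Lemma sum_mulnD m n (F : nat -> K) :
  \sum_(t < m * n) F t = \sum_(i < m) \sum_(j < n) F (i * n + j)%N.
Proof.
rewrite -(big_mkord xpredT F) big_nat_mul big_mkord; apply: eq_bigr => i _.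
rewrite -{1}[(i * n)%N]add0n big_addn mulSn addnK big_mkord.
by apply: eq_bigr => j _; rewrite addnC.
Qed.

Lemma sum_residue_class m n u (c : K) : (u < n)%N ->
  \sum_(t < m * n | (t %% n)%N == u) c = c *+ m.
Proof.
move=> ltu.
rewrite big_mkcond (sum_mulnD m n (fun t => if (t %% n)%N == u then c else 0)).
rewrite (eq_bigr (fun=> c)) => [|i _]; first by rewrite sumr_const card_ord.
rewrite (bigD1 (Ordinal ltu)) //= modnMDl modn_small // eqxx big1 ?addr0 // => j.
by rewrite -val_eqE /= modnMDl modn_small // => /negPf->.
Qed.

Lemma sum_multiples m n (F : nat -> K) : (0 < m)%N ->
  \sum_(t < m * n | (m %| t)%N) F t = \sum_(q < n) F (q * m)%N.
Proof.
move=> m0.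
rewrite big_mkcond mulnC (sum_mulnD n m (fun t => if (m %| t)%N then F t else 0)).
apply: eq_bigr => i _; rewrite (bigD1 (Ordinal m0)) //= addn0 dvdn_mull // big1 ?addr0 // => j.
by rewrite -val_eqE /= -lt0n dvdn_addr ?dvdn_mull // => j0; rewrite gtnNdvd.
Qed.

(** As [l] has period [n], the pairing sees [b] only through its sums over residue classes modulo
    [n]. *)
Lemma nondegenerate_mod_fibers n l (m : nat) b : (0 < n)%N ->
    nondegenerate_mod n l ->
    (forall k, \sum_(t < m) b t * l (k * t)%N = 0) ->
  forall u, (u < n)%N -> \sum_(t < m | (t %% n)%N == u) b t = 0.
Proof.
move=> n0 [ln nd] bl.
apply: (nd (fun u => \sum_(t < m | (t %% n)%N == u) b t)) => k.
rewrite -[RHS](bl k) (@sum_residues m n b (fun t => l (k * t)%N)) // => t.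
by rewrite -ln modnMmr ln.
Qed.

Lemma nondegenerate_mod1 : nondegenerate_mod 1 (fun=> 1).
Proof.
split=> // b /(_ 0%N); rewrite big_ord1 mulr1 => b0 t.
by rewrite ltnS leqn0 => /eqP->.
Qed.

(** By the Chinese remainder theorem, the matrix is a tensor product of those of [l] and [l']. *)
Lemma nondegenerate_modM m n l l' : coprime m n -> (0 < m)%N -> (0 < n)%N ->
    nondegenerate_mod m l -> nondegenerate_mod n l' ->
  nondegenerate_mod (m * n) (fun t => l t * l' t).
Proof.
move=> co m0 n0 [lm ndm] [ln ndn]; split=> [t|b bl t lt_t].
  by rewrite -lm modn_dvdm ?dvdn_mulr // lm -ln modn_dvdm ?dvdn_mull // ln.
have fib1 k u : (u < m)%N ->
    \sum_(t < m * n | (t %% m)%N == u) b t * l' (k * t)%N = 0.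
  apply: (@nondegenerate_mod_fibers m l (m * n) (fun t => b t * l' (k * t)%N)) => // j.
  (* In this row, [l] sees only [j] and [l'] only [k]. *)
  rewrite -[RHS](bl (chinese m n j k)); apply: eq_bigr => s _.
  rewrite -mulrA [l' _ * _]mulrC; congr (_ * (_ * _)).
    by rewrite -lm -modnMml -(chinese_modl co j k) modnMml lm.
  by rewrite -ln -modnMml -(chinese_modr co j k) modnMml ln.
(* Once [b] is restricted to the class of [t] modulo [m], the class of [t] modulo [n] retains only
   [t]. *)
have := @nondegenerate_mod_fibers n l' (m * n)
  (fun s => if (s %% m == t %% m)%N then b s else 0) n0 (conj ln ndn).
have H k : \sum_(s < m * n) (if (s %% m == t %% m)%N then b s else 0) * l' (k * s)%N = 0.
  rewrite -[RHS](fib1 k (t %% m)%N (ltn_pmod _ m0)) [RHS]big_mkcond.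
  by apply: eq_bigr => s _; case: ifP; rewrite ?mul0r.
move=> /(_ H (t %% n)%N (ltn_pmod _ n0)).
rewrite (bigD1 (Ordinal lt_t)) //= eqxx big1 ?addr0 // => s /andP[/eqP sn ne].
case: ifP => // /eqP sm; case/negP: ne; rewrite -val_eqE /=.
move/eqP: sm; move/eqP: sn => sn sm.
have : (s == t %[mod m * n])%N by rewrite chinese_remainder // sm sn.
by rewrite !modn_small.
Qed.

(** * Nondegenerate functions modulo prime powers *)

Section PrimePower.
Variable p : nat.
Hypothesis p_pr : prime p.

(** For [n = p * N] with [N] a power of [p], the row of a unit [k] has a single nonzero entry
    outside the multiples of [p], at the inverse of [k]. The row of [p * k] repeats the row of [k]
    for [l']. *)
Definition prime_lift n (l' : nat -> K) t : K :=
  if (p %| t)%N then l' (t %/ p)%N else (t == 1 %[mod n])%:R.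

Lemma prime_lift_mod N l' : (forall t, l' (t %% N)%N = l' t) ->
  forall t, prime_lift (p * N) l' (t %% (p * N))%N = prime_lift (p * N) l' t.
Proof.
move=> l'N t; rewrite /prime_lift modn_mod.
have -> : (p %| t %% (p * N))%N = (p %| t)%N.
  by rewrite /dvdn modn_dvdm // dvdn_mulr.
case: ifP => // /dvdnP[q ->].
by rewrite [(p * N)%N]mulnC -muln_modl !mulnK ?prime_gt0 // l'N.
Qed.

(** An inverse by Euler's theorem. Being a power of [u], its residue modulo [N] depends only on that
    of [u]. *)
Definition inv_mod n u := (u ^ (totient n).-1)%N.

Lemma inv_modP n u : (0 < n)%N -> coprime u n -> (inv_mod n u * u = 1 %[mod n])%N.
Proof.
by move=> n0 un; rewrite -expnSr prednK ?totient_gt0 // Euler_exp_totient.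
Qed.

(* The sum depends only on u modulo N: comparing with the vanishing of the sums
   of b over residue classes modulo N will give b u = 0. *)
Lemma prime_lift_unit N l' b j u : (N = p ^ j)%N ->
    (forall t, l' (t %% N)%N = l' t) ->
    (forall k, \sum_(t < p * N) b t * prime_lift (p * N) l' (k * t)%N = 0) ->
    (u < p * N)%N -> ~~ (p %| u)%N ->
  b u = - \sum_(t < p * N | (p %| t)%N)
     b t * l' (inv_mod (p * N) u * (t %/ p))%N.
Proof.
move=> Nj l'N bl ltu pu; apply/eqP; rewrite -addr_eq0; apply/eqP.
have n0 : (0 < p * N)%N by case: (p * N)%N ltu.
have p_gt0 := prime_gt0 p_pr.
have un : coprime u (p * N).
  by rewrite Nj -expnS coprime_sym coprime_pexpl // prime_coprime.
have ku := inv_modP n0 un; set k := inv_mod _ u in ku *.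
have kn : coprime k (p * N) by rewrite coprimeXl.
have pk : ~~ (p %| k)%N.
  by rewrite -prime_coprime // coprime_sym (coprime_dvdr _ kn) // dvdn_mulr.
have := bl k; rewrite (bigID (fun t : 'I_ _ => p %| t)%N) /= addrC.
rewrite (bigD1 (Ordinal ltu)) //= big1 ?addr0 => [|t /andP[pt ne_tu]].
  rewrite /prime_lift Euclid_dvdM // (negPf pk) (negPf pu) /= ku eqxx mulr1 => bu.
  rewrite -[RHS]bu; congr (_ + _); apply: eq_bigr => t pt.
  by rewrite dvdn_mull // muln_divA.
rewrite /prime_lift Euclid_dvdM // (negPf pk) (negPf pt) /=.
case: eqP => [kt|_]; last by rewrite mulr0.
case/negP: ne_tu; rewrite -val_eqE /= -[eqbLHS](modn_small (ltn_ord t)).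
rewrite -[eqbRHS](modn_small ltu).
by rewrite -[X in (X %% _)%N]mul1n -modnMml -ku modnMml mulnAC -modnMml kt modnMml mul1n.
Qed.

(** Unit rows give [b u = - (b 0 / p)] for [u != 0], and row 0 makes the sum of [b] vanish. This sum
    is [b 0 - (p - 1) * b 0 / p = b 0 / p], which motivates the constant [p%:R^-1]. *)
Lemma nondegenerate_mod_prime : p%:R != 0 :> K ->
  nondegenerate_mod p (prime_lift p (fun=> p%:R^-1)).
Proof.
move=> p0; split=> [t|b bl].
  by have := @prime_lift_mod 1 (fun=> p%:R^-1) (fun=> erefl _) t; rewrite muln1.
have p_gt0 := prime_gt0 p_pr.
have bu u : (u < p)%N -> u != 0%N -> b u = - (b 0%N / p%:R).
  move=> ltu u0.
  have pu : ~~ (p %| u)%N by rewrite gtnNdvd // lt0n.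
  have := @prime_lift_unit 1 (fun=> p%:R^-1) b 0 u (erefl _) (fun=> erefl _).
  rewrite muln1 => /(_ bl ltu pu) ->.
  rewrite (bigD1 (Ordinal p_gt0)) ?dvdn0 //= big1 ?addr0 // => s /andP[ps].
  by rewrite -val_eqE /= -lt0n => s0; rewrite gtnNdvd in ps.
have b0 : b 0%N = 0.
  have pV0 : p%:R^-1 != 0 :> K by rewrite invr_eq0.
  have := bl 0%N.
  under eq_bigr => t _ do rewrite mul0n /prime_lift dvdn0.
  rewrite -mulr_suml => /eqP; rewrite mulf_eq0 (negPf pV0) orbF.
  rewrite (bigD1 (Ordinal p_gt0)) //= (eq_bigr (fun=> - (b 0%N / p%:R))).
    rewrite sumr_const cardC1 card_ord mulNrn -[_ / _ *+ _]mulr_natr -subn1 natrB //.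
    rewrite mulrBr mulr1 divfK // opprB addrCA subrr addr0.
    by rewrite mulf_eq0 (negPf pV0) orbF => /eqP.
  by move=> t t0; apply: bu.
move=> t ltp; have [->|t0] := eqVneq t 0%N; first by rewrite b0.
by rewrite bu // b0 mul0r oppr0.
Qed.

(** The rows of multiples of [p] kill the sums of [b] over classes modulo [N]. As [p] divides [N], a
    class of units contains no multiple of [p]; [b] is constant on its [p] elements, hence zero
    there. On the multiples of [p], the rows reduce to those of [l']. *)
Lemma nondegenerate_mod_primeM N j l' : p%:R != 0 :> K -> (N = p ^ j.+1)%N ->
  nondegenerate_mod N l' -> nondegenerate_mod (p * N) (prime_lift (p * N) l').
Proof.
move=> p0 Nj [l'N nd]; split=> [|b bl]; first exact: prime_lift_mod.
have p_gt0 := prime_gt0 p_pr.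
have N_gt0 : (0 < N)%N by rewrite Nj expn_gt0 p_gt0.
have pN : (p %| N)%N by rewrite Nj expnS dvdn_mulr.
have fib : forall u, (u < N)%N -> \sum_(t < p * N | (t %% N)%N == u) b t = 0.
  apply: (@nondegenerate_mod_fibers N l') => // k.
  rewrite -[RHS](bl (p * k)%N); apply: eq_bigr => t _.
  by rewrite -mulnA /prime_lift dvdn_mulr // mulKn.
have bu u : (u < p * N)%N -> ~~ (p %| u)%N -> b u = 0.
  move=> ltu pu; have := fib (u %% N)%N (ltn_pmod _ N_gt0).
  rewrite (eq_bigr (fun=> b u)) => [|t /eqP tu].
    rewrite sum_residue_class ?ltn_pmod // -mulr_natr => /eqP.
    by rewrite mulf_eq0 (negPf p0) orbF => /eqP.
  have pt : ~~ (p %| t)%N by rewrite /dvdn -(modn_dvdm t pN) tu modn_dvdm.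
  rewrite (prime_lift_unit Nj l'N bl) // (prime_lift_unit Nj l'N bl ltu) //.
  congr (- _); apply: eq_bigr => s _; congr (_ * _).
  rewrite -l'N -[RHS]l'N; congr (l' _).
  by rewrite -modnMml -[in RHS]modnMml /inv_mod -modnXm tu modnXm.
move=> t ltt; have [/dvdnP[q def_t]|] := boolP (p %| t)%N; last exact: bu.
rewrite def_t; apply: (nd (fun q => b (q * p)%N)); last first.
  by rewrite -(ltn_pmul2l p_gt0) mulnC -def_t.
move=> k; rewrite -[RHS](bl k).
rewrite [RHS](bigID (fun t : 'I_ _ => p %| t)%N) /= [X in _ + X]big1 => [|s ps]; last first.
  by rewrite bu ?mul0r.
rewrite addr0 (sum_multiples N (fun t => b t * _ (k * t)%N)) //.
apply: eq_bigr => s _.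
by rewrite /prime_lift mulnA dvdn_mull // mulnK.
Qed.

Lemma exists_nondegenerate_mod_prime_exp j : p%:R != 0 :> K ->
  exists l, nondegenerate_mod (p ^ j.+1) l.
Proof.
move=> p0; elim: j => [|j [l nd_l]].
  by eexists; rewrite expn1; apply: nondegenerate_mod_prime.
by eexists; rewrite expnS; apply: nondegenerate_mod_primeM nd_l.
Qed.

End PrimePower.

Lemma exists_nondegenerate_mod n : n%:R != 0 :> K ->
  exists l, nondegenerate_mod n l.
Proof.
elim/ltn_ind: n => n IHn n0; have n_gt0 : (0 < n)%N by case: n n0 {IHn}; rewrite ?eqxx.
have [n_le1|n_gt1] := leqP n 1.
  exists (fun=> 1); rewrite (eqP (_ : n == 1%N)) ?eqn_leq ?n_le1 //.
  exact: nondegenerate_mod1.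
have p_pr := pdiv_prime n_gt1; set p := pdiv n in p_pr.
have [m pm def_n] := pfactor_coprime p_pr n_gt0.
move: n0; rewrite def_n natrM natrX mulf_eq0 negb_or => /andP[m0].
have lp : (0 < logn p n)%N by rewrite logn_gt0 mem_primes p_pr n_gt0 pdiv_dvd.
rewrite expf_eq0 lp /= => p0.
have m_gt0 : (0 < m)%N by case: m m0 {pm def_n}; rewrite ?eqxx.
have [|l nd_l] := IHn m _ m0.
  rewrite [ltnRHS]def_n -[ltnLHS]muln1 ltn_pmul2l //.
  by rewrite -(expn0 p) ltn_exp2l // prime_gt1.
have [l' nd_l'] := exists_nondegenerate_mod_prime_exp p_pr (logn p n).-1 p0.
rewrite prednK // in nd_l'.
exists (fun t => l t * l' t); apply: nondegenerate_modM => //.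
  by rewrite coprime_sym coprimeXl.
Qed.

End ResidueForms.

(** * Counting morphisms between submodules of the left socle *)

Section LeftIdeals.
Variable R : finPzRingType.
Implicit Types (a c e m r s x y : R) (I L T : {set R}).

Lemma left_ideal0 I : left_ideal I -> 0 \in I.
Proof. by case/andP. Qed.

Lemma left_idealD I : left_ideal I -> {in I &, forall x y, x + y \in I}.
Proof.
by case/left_idealP=> _ IL x y Ix Iy; rewrite -[x]mul1r; apply: (IL 1 x y).
Qed.

Lemma left_idealM I : left_ideal I -> forall r, {in I, forall x, r * x \in I}.
Proof.
case/left_idealP=> I0 IL r x Ix.
by rewrite -[_ * x]addr0; apply: (IL r x 0).
Qed.

Lemma left_idealN I : left_ideal I -> {in I, forall x, - x \in I}.
Proof. by move=> IL x Ix; rewrite -mulN1r left_idealM. Qed.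

Lemma left_idealB I : left_ideal I -> {in I &, forall x y, x - y \in I}.
Proof. by move=> IL x y Ix Iy; rewrite left_idealD ?left_idealN. Qed.

Lemma left_ideal_set0 : left_ideal [set (0 : R)].
Proof.
apply/left_idealP; split=> [|a x y]; rewrite !inE // => /eqP-> /eqP->.
by rewrite scaler0 addr0.
Qed.

Definition principal x : {set R} := [set r * x | r in R].

Lemma principalP x y : reflect (exists r, y = r * x) (y \in principal x).
Proof.
by apply: (iffP imsetP) => [[r _ ->]|[r ->]]; exists r.
Qed.

Lemma mem_principal r x : r * x \in principal x.
Proof. by apply/principalP; exists r. Qed.

Lemma principal_id x : x \in principal x.
Proof. by apply/principalP; exists 1; rewrite mul1r. Qed.

Lemma principal_left_ideal x : left_ideal (principal x).
Proof.
apply/left_idealP; split=> [|a _ _ /principalP[r ->] /principalP[s ->]].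
  by apply/principalP; exists 0; rewrite mul0r.
by apply/principalP; exists (a * r + s); rewrite mulrDl -mulrA.
Qed.
Local Hint Resolve principal_left_ideal : core.

Lemma principal_sub I x : left_ideal I -> x \in I -> principal x \subset I.
Proof. by move=> IL Ix; apply/subsetP=> _ /principalP[r ->]; rewrite left_idealM. Qed.

Lemma minimal_left_idealL L : minimal_left_ideal L -> left_ideal L.
Proof. by case/minsetp/andP. Qed.

Lemma minimal_left_ideal_principal L x : minimal_left_ideal L ->
  x \in L -> x != 0 -> principal x = L.
Proof.
move=> /minsetP[/andP[LL _] minL] Lx x0; apply: minL; last exact: principal_sub.
rewrite /= principal_left_ideal; apply: contraNneq x0 => /setP/(_ x).
by rewrite principal_id inE => /esym.
Qed.

Definition simple_elt x := minimal_left_ideal (principal x).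

Lemma simple_elt_neq0 x : simple_elt x -> x != 0.
Proof.
case/minsetp/andP=> _; apply: contraNneq => ->; apply/eqP/setP=> y.
rewrite inE; apply/principalP/eqP => [[r ->]|->]; first by rewrite mulr0.
by exists 0; rewrite mulr0.
Qed.

Lemma simple_elt_divr x y : simple_elt x -> y \in principal x -> y != 0 ->
  exists r, x = r * y.
Proof.
move=> sx xy y0; apply/principalP.
by rewrite (minimal_left_ideal_principal sx xy y0) principal_id.
Qed.

Lemma exists_minimal_left_ideal I x : left_ideal I -> x \in I -> x != 0 ->
  exists2 L, minimal_left_ideal L & L \subset I.
Proof.
move=> IL Ix x0; have [|L minL sLI] := @minset_exists _
  [pred L : {set R} | left_ideal L && (L != [set 0])] I; last by exists L.
rewrite /= IL; apply: contraNneq x0 => I0; by rewrite I0 inE in Ix.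
Qed.

Lemma minimal_left_ideal_simple L : minimal_left_ideal L ->
  exists2 x, simple_elt x & principal x = L.
Proof.
move=> minL; have /minsetp/andP[LL L0] := minL.
have [x Lx x0] : exists2 x, x \in L & x != 0.
  apply/exists_inP; apply: contraNT L0; rewrite negb_exists_in => /forall_inP L0.
  apply/eqP/setP=> y; rewrite inE; apply/idP/eqP => [/L0|->]; last exact: left_ideal0.
  by move/negPn/eqP.
by exists x; rewrite ?/simple_elt (minimal_left_ideal_principal minL Lx x0).
Qed.

Definition add_set I T : {set R} := [set p.1 + p.2 | p in setX I T].

Lemma add_setP I T x : reflect (exists y z, [/\ y \in I, z \in T & x = y + z])
  (x \in add_set I T).
Proof.
apply: (iffP imsetP) => [[[y z]]|[y [z [Iy Tz ->]]]].
  by rewrite inE /= => /andP[Iy Tz] ->; exists y, z.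
by exists (y, z) => //; rewrite inE Iy.
Qed.

Lemma add_set_left_ideal I T : left_ideal I -> left_ideal T ->
  left_ideal (add_set I T).
Proof.
move=> II TT; apply/left_idealP; split=> [|a x y].
  by apply/add_setP; exists 0, 0; rewrite addr0 !left_ideal0.
move=> /add_setP[x1 [x2 [x1I x2T ->]]] /add_setP[y1 [y2 [y1I y2T ->]]].
apply/add_setP; exists (a * x1 + y1), (a * x2 + y2).
by rewrite !left_idealD ?left_idealM // scalerDr addrACA.
Qed.

(** Take [T] maximal among the left ideals meeting [L] in 0. A minimal left ideal [N] not inside
    [L + T] would meet it in 0, and [T + N] would contradict maximality. *)
Lemma left_socle_complement L : minimal_left_ideal L ->
  exists T, [/\ left_ideal T, forall x, x \in L -> x \in T -> x = 0
    & forall c, c \in @left_socle R -> exists m t, [/\ m \in L, t \in T & c = m + t]].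
Proof.
move=> minL; have LL := minimal_left_idealL minL.
pose P := [pred T : {set R} | left_ideal T && [forall x in L, (x \in T) ==> (x == 0)]].
have [T /maxsetP[/andP[TT /forall_inP LT0] maxT] _] : {T | maxset P T & [set 0] \subset T}.
  apply: maxset_exists; rewrite /= left_ideal_set0; apply/forall_inP=> x _.
  by rewrite inE implybb.
have LT x : x \in L -> x \in T -> x = 0 by move=> /LT0/implyP Lx /Lx/eqP.
exists T; split=> // c /existsP[f /andP[/forall_inP fI /eqP ->]].
have addL := add_set_left_ideal LL TT.
suff: \sum_(I : {set R} | minimal_left_ideal I) f I \in add_set L T.
  by case/add_setP=> m [t [Lm Tt ->]]; exists m, t.
elim/big_ind: _ => [|x y|N minN]; [exact: left_ideal0 | exact: left_idealD |].
have NN := minimal_left_idealL minN.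
apply/negPn/negP=> fN.
have disj x : x \in N -> x \in add_set L T -> x = 0.
  move=> Nx LTx; apply/eqP/negPn/negP=> x0; case/negP: fN.
  apply: (subsetP (principal_sub addL LTx)).
  by rewrite (minimal_left_ideal_principal minN) ?fI.
have TN : add_set T N = T.
  apply: maxT => /=; last first.
    by apply/subsetP=> x Tx; apply/add_setP; exists x, 0; rewrite left_ideal0 ?addr0.
  rewrite add_set_left_ideal //; apply/forall_inP=> x Lx; apply/implyP.
  move=> /add_setP[t [y [Tt Ny def_x]]].
  suff y0 : y = 0 by rewrite def_x y0 addr0 in Lx *; rewrite (LT t).
  apply: disj => //; apply/add_setP; exists x, (- t).
  by rewrite left_idealN // def_x addrAC subrr add0r; split=> //; rewrite -def_x.
case/negP: fN; apply/add_setP; exists 0, (f N); rewrite left_ideal0 // add0r; split=> //.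
by rewrite -TN; apply/add_setP; exists 0, (f N); rewrite left_ideal0 // add0r fI.
Qed.

Lemma simple_elt_socle x : simple_elt x -> x \in @left_socle R.
Proof.
move=> sx; apply/existsP; exists [ffun I => if I == principal x then x else 0].
apply/andP; split.
  apply/forall_inP=> I minI; rewrite ffunE; case: eqP => [->|_]; first exact: principal_id.
  exact/left_ideal0/minimal_left_idealL.
rewrite (bigD1 (principal x)) //= ffunE eqxx big1 ?addr0 // => I /andP[_ /negPf nI].
by rewrite ffunE nI.
Qed.

Lemma left_socleM r x : x \in @left_socle R -> r * x \in @left_socle R.
Proof.
have [s0 sZ] := @left_socle_submod_closed R.
by move=> sx; rewrite -[_ * x]addr0; apply: (sZ r x 0).
Qed.

Lemma left_socleB x y : x \in @left_socle R -> y \in @left_socle R -> x - y \in @left_socle R.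
Proof.
have [s0 sZ] := @left_socle_submod_closed R.
by move=> sx sy; rewrite -mulN1r addrC; apply: (sZ (-1) y x).
Qed.

(** The elements [m] and [c'] are the components of [c] in a minimal left ideal [L] inside [Rc] and
    in its complement [T]. If [m = e * c], then [e * c' = m - e * m] lies in both [T] and [L], so it
    is 0. *)
Lemma left_socle_split c : c \in @left_socle R -> c != 0 ->
  exists m c' e, [/\ c = m + c', simple_elt m, c' \in @left_socle R,
    (forall r s, r * m = s * c' -> r * m = 0) & e * m = m /\ e * c' = 0].
Proof.
move=> cS c0.
have [L minL sLc] := exists_minimal_left_ideal (principal_left_ideal c) (principal_id c) c0.
have LL := minimal_left_idealL minL.
have [T [TT LT /(_ c cS)[m [c' [Lm Tc' def_c]]]]] := left_socle_complement minL.
have [x sx Lx] := minimal_left_ideal_simple minL.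
have xL : x \in L by rewrite -Lx principal_id.
(* Otherwise [T] would contain [c], hence [L]. *)
have m0 : m != 0.
  apply: contraNneq (simple_elt_neq0 sx) => m0; apply/eqP/LT => //.
  apply: (subsetP (principal_sub TT _)) (subsetP sLc x xL).
  by rewrite def_c m0 add0r.
have mL := minimal_left_ideal_principal minL Lm m0.
have /principalP[e em] : m \in principal c by exact: (subsetP sLc).
have ec' : e * c' = 0.
  apply: LT; last exact: left_idealM.
  have -> : e * c' = m - e * m by rewrite {1}em def_c mulrDr addrC addKr.
  by rewrite left_idealB ?left_idealM.
exists m, c', e; split=> //; first by rewrite /simple_elt mL.
- have -> : c' = c - m by rewrite def_c addrC addKr.
  by rewrite left_socleB // em left_socleM.
- move=> r s rmsc; apply: LT; first exact: left_idealM.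
  by rewrite rmsc left_idealM.
by split=> //; rewrite {2}em def_c mulrDr ec' addr0.
Qed.

(* The morphisms h from the cyclic module Rx to I, encoded by h x. *)
Definition hom_elts x I : {set R} :=
  [set y in I | [forall r, (r * x == 0) ==> (r * y == 0)]].

Lemma hom_eltsP x I y :
  reflect (y \in I /\ forall r, r * x = 0 -> r * y = 0) (y \in hom_elts x I).
Proof.
rewrite inE; apply: (iffP andP) => -[Iy H]; split=> //.
  by move=> r /eqP rx; apply/eqP; apply: implyP rx; apply: forallP H r.
by apply/forallP=> r; apply/implyP=> /eqP/H->.
Qed.

(** Schur's lemma: a nonzero morphism from a simple module is injective. *)
Lemma hom_elts_simple_ann x I y r : simple_elt x -> y \in hom_elts x I ->
  y != 0 -> r * y = 0 -> r * x = 0.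
Proof.
move=> sx /hom_eltsP[_ xy] y0 ry; apply/eqP; apply: contraNT y0 => rx.
have [t def_x] := simple_elt_divr sx (mem_principal r x) rx.
have /xy : (1 - t * r) * x = 0 by rewrite mulrBl mul1r -mulrA -def_x subrr.
by rewrite mulrBl mul1r -mulrA ry mulr0 subr0 => ->.
Qed.

(** A nonzero [h : Rx -> Rm] is invertible, and [g |-> h^-1 g h^-1] injects the morphisms [Rx -> Rm]
    into the morphisms [Rm -> Rx]. *)
Lemma card_hom_elts_simple x m : simple_elt x -> simple_elt m ->
  (#|hom_elts x (principal m)| <= #|hom_elts m (principal x)|)%N.
Proof.
move=> sx sm.
have z0 : 0 \in hom_elts m (principal x).
  by apply/hom_eltsP; split=> [|r _]; rewrite ?left_ideal0 ?mulr0.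
case: (boolP [exists y in hom_elts x (principal m), y != 0]); last first.
  rewrite negb_exists_in => /forall_inP H.
  have: hom_elts x (principal m) \subset [set 0].
    by apply/subsetP=> y /H/negPn/eqP->; rewrite inE.
  move/subset_leq_card; rewrite cards1 => /leq_trans->//.
  by rewrite card_gt0; apply/set0Pn; exists 0.
case/exists_inP=> y Hy y0; have /hom_eltsP[my xy] := Hy.
have [s def_m] := simple_elt_divr sm my y0.
have ex y' : y' \in hom_elts x (principal m) -> exists u, s * y' == u * y.
  case/hom_eltsP=> /principalP[q ->] _; exists (s * q * s).
  by rewrite -!mulrA -def_m.
(* With [y = h x], [y' = g x] and [m = s * y], the map [h^-1 g h^-1] sends [m] to [u * x]. The
   default 0 is never reached on [hom_elts]. *)
pose f y' := if [pick u | s * y' == u * y] is Some u then u * x else 0.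
have fP y' : y' \in hom_elts x (principal m) ->
    exists2 u, s * y' = u * y & f y' = u * x.
  move=> /ex[u0 Hu0]; rewrite /f; case: pickP => [u /eqP|/(_ u0)]; first by exists u.
  by rewrite Hu0.
rewrite -(card_in_imset (f := f)).
  apply/subset_leq_card/subsetP=> _ /imsetP[y' Hy' ->].
  have [u su ->] := fP y' Hy'; apply/hom_eltsP; split=> [|r]; first exact: mem_principal.
  rewrite def_m mulrA => /(hom_elts_simple_ann sx Hy y0).
  have /hom_eltsP[_ xy'] := Hy'.
  move/xy'; rewrite -mulrA su mulrA => /(hom_elts_simple_ann sx Hy y0).
  by rewrite -mulrA.
move=> y1 y2 H1 H2; have [u1 su1 ->] := fP y1 H1; have [u2 su2 ->] := fP y2 H2.
move=> eq_ux; apply/eqP; rewrite -subr_eq0; apply/negPn/negP=> y12.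
have {eq_ux} : (u1 - u2) * x = 0 by rewrite mulrBl eq_ux subrr.
move/xy; rewrite mulrBl -su1 -su2 -mulrBr => sy.
have H12 : y1 - y2 \in hom_elts x (principal m).
  have [/hom_eltsP[? h1] /hom_eltsP[? h2]] := (H1, H2).
  apply/hom_eltsP; split=> [|r rx]; first exact: left_idealB.
  by rewrite mulrBr h1 // h2 // subrr.
have := xy s (hom_elts_simple_ann sx H12 y12 sy).
by rewrite -def_m; apply/eqP/simple_elt_neq0.
Qed.

(** * Morphisms from and to a direct sum *)

Section Split.
Variables m c' e : R.
Hypothesis sm : simple_elt m.
(* The sum of Rm and Rc' is direct. *)
Hypothesis dmc : forall r s, r * m = s * c' -> r * m = 0.
Hypotheses (em : e * m = m) (ec' : e * c' = 0).

Lemma card_principal_split : (#|principal c'| < #|principal (m + c')%R|)%N.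
Proof.
apply/proper_card/properP; split.
  apply: principal_sub => //; apply/principalP; exists (1 - e).
  by rewrite mulrDr !mulrBl !mul1r em ec' subrr add0r subr0.
exists m; first by apply/principalP; exists e; rewrite mulrDr em ec' addr0.
apply: contraNN (simple_elt_neq0 sm) => /principalP[r].
by rewrite -[X in X = _]mul1r => /dmc; rewrite mul1r => ->.
Qed.

Lemma direct_split_eq0 r s : r * m + s * c' = 0 -> r * m = 0 /\ s * c' = 0.
Proof.
move=> rs; have rm : r * m = 0.
  by apply: (@dmc r (- s)); apply/eqP; rewrite mulNr -addr_eq0 rs.
by split=> //; rewrite rm add0r in rs.
Qed.

Lemma card_hom_elts_from x :
  (#|hom_elts m (principal x)| * #|hom_elts c' (principal x)| <=
   #|hom_elts (m + c')%R (principal x)|)%N.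
Proof.
rewrite -cardsX -(card_in_imset (f := fun p : R * R => p.1 + p.2)).
  apply/subset_leq_card/subsetP=> _ /imsetP[[y1 y2]] /setXP[/= H1 H2 ->].
  move/hom_eltsP: H1 => [y1x H1]; move/hom_eltsP: H2 => [y2x H2].
  apply/hom_eltsP; split=> [|r]; first exact: left_idealD.
  by rewrite mulrDr => /direct_split_eq0[/H1 r1 /H2 r2]; rewrite mulrDr r1 r2 addr0.
(* Multiplication by [e] recovers [y1] from the sum, which gives injectivity. *)
have H y1 y2 : y1 \in hom_elts m (principal x) -> y2 \in hom_elts c' (principal x) ->
    e * (y1 + y2) = y1.
  move=> /hom_eltsP[_ H1] /hom_eltsP[_ H2]; rewrite mulrDr (H2 e ec') addr0.
  have /H1 : (e - 1) * m = 0 by rewrite mulrBl em mul1r subrr.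
  by rewrite mulrBl mul1r => /eqP; rewrite subr_eq0 => /eqP.
move=> [y1 y2] [z1 z2] /setXP[/= y1H y2H] /setXP[/= z1H z2H] eq_yz.
have y1z1 : y1 = z1 by rewrite -(H y1 y2) // eq_yz H.
by move: eq_yz; rewrite y1z1 => /addrI ->.
Qed.

(** The components [r * m] and [r * c'] determine [y], and each is an image of [x] because a
    relation in a direct sum holds componentwise. *)
Lemma card_hom_elts_to x :
  (#|hom_elts x (principal (m + c')%R)| <=
   #|hom_elts x (principal m)| * #|hom_elts x (principal c')|)%N.
Proof.
pose f y := if [pick r | y == r * (m + c')] is Some r then (r * m, r * c') else (0, 0).
have fP y : y \in hom_elts x (principal (m + c')) ->
    exists2 r, y = r * m + r * c' & f y = (r * m, r * c').
  case/hom_eltsP=> /principalP[r0 def_y] _; rewrite /f.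
  by case: pickP => [r /eqP->|/(_ r0)]; [exists r; rewrite // mulrDr | rewrite def_y eqxx].
rewrite -cardsX.
rewrite -(card_in_imset (f := f)) => [|y1 y2 /fP[r1 -> ->] /fP[r2 -> ->] [-> ->] //].
apply/subset_leq_card/subsetP=> _ /imsetP[y Hy ->].
have /hom_eltsP[_ xy] := Hy; have [r def_y ->] := fP y Hy.
have kill s : s * x = 0 -> s * (r * m) = 0 /\ s * (r * c') = 0.
  by move/xy; rewrite def_y mulrDr !mulrA => /direct_split_eq0.
by apply/setXP; split; apply/hom_eltsP; split=> [|s /kill[]] //; apply: mem_principal.
Qed.

End Split.

Lemma card_hom_elts_socle c x : c \in @left_socle R -> simple_elt x ->
  (#|hom_elts x (principal c)| <= #|hom_elts c (principal x)|)%N.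
Proof.
move=> + sx; have [n] := ubnP #|principal c|; elim: n c => // n IHn c lt_c cS.
have [->|c0] := eqVneq c 0.
  have: hom_elts x (principal 0) \subset [set 0].
    by apply/subsetP=> _ /hom_eltsP[/principalP[r ->] _]; rewrite mulr0 inE.
  move/subset_leq_card; rewrite cards1 => /leq_trans->//.
  rewrite card_gt0; apply/set0Pn; exists 0; apply/hom_eltsP.
  by split=> [|r _]; rewrite ?left_ideal0 ?mulr0.
have [m [c' [e [def_c sm c'S dmc [em ec']]]]] := left_socle_split cS c0.
rewrite def_c in lt_c *.
apply: leq_trans (card_hom_elts_from dmc em ec' x).
apply: leq_trans (card_hom_elts_to dmc x) _.
apply: leq_mul; first exact: card_hom_elts_simple.
apply: IHn => //; exact: leq_trans (card_principal_split sm dmc em ec') _.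
Qed.

(** Strictness: no morphism sends [c'] to [m], since [e] kills [c'] but not [m]. *)
Lemma card_hom_elts_split m c' e : simple_elt m -> c' \in @left_socle R ->
    e * m = m -> e * c' = 0 ->
  (#|hom_elts m (principal c')| < #|principal m|)%N.
Proof.
move=> sm c'S em ec'; apply: leq_ltn_trans (card_hom_elts_socle c'S sm) _.
apply/proper_card/properP; split; first by apply/subsetP=> y /hom_eltsP[].
exists m; first exact: principal_id.
apply: contraNN (simple_elt_neq0 sm) => /hom_eltsP[_ /(_ e ec')].
by rewrite em => ->.
Qed.

End LeftIdeals.

(** * A generating character *)

Section LinearCharacters.
Variables (gT : finGroupType) (G : {group gT}).
Hypothesis abG : abelian G.

(** By Frobenius reciprocity, a constituent of the induced character restricts to a linear character
    with constituent [theta], hence to [theta]. *)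
Lemma extend_lin_char (H : {group gT}) (theta : 'CF(H)) : H \subset G ->
  theta \is a linear_char ->
  exists2 chi : 'CF(G), chi \is a linear_char & 'Res[H] chi = theta.
Proof.
move=> sHG lin_theta.
have /irrP[i ->] := lin_char_irr lin_theta.
have [j] := constt_cfInd_irr i sHG; rewrite constt_Ind_Res => ij.
have lin_j : 'chi_j \is a linear_char by apply/char_abelianP.
exists 'chi_j => //; have /irrP[k res_j] := lin_char_irr (cfRes_lin_char H lin_j).
by move: ij; rewrite res_j constt_irr inE => /eqP->.
Qed.

Lemma glue_lin_char (H K : {group gT}) (theta : 'CF(H)) (psi : 'CF(G)) :
    H \subset G -> K \subset G -> (H :&: K)%g = 1%g ->
    theta \is a linear_char -> psi \is a linear_char ->
  exists chi : 'CF(G), [/\ chi \is a linear_char, {in H, chi =1 theta}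
    & {in K, chi =1 psi}].
Proof.
move=> sHG sKG tiHK lin_theta lin_psi.
have cHK : K \subset 'C(H)%g by apply: (sub_abelian_cent2 abG).
have HxK : (H \x K)%g = (H <*> K)%G by rewrite dprodEY.
have lin_res := cfRes_lin_char K lin_psi.
have sHKG : (H <*> K)%G \subset G by rewrite join_subG sHG.
have [chi lin_chi def_chi] := extend_lin_char sHKG (cfDprod_lin_char HxK lin_theta lin_res).
exists chi; split=> // x Hx.
  rewrite -(cfResE _ sHKG) ?def_chi; last by rewrite mem_gen // inE Hx.
  by rewrite -[x]mulg1 cfDprodE // (lin_char1 lin_res) mulr1 mulg1.
rewrite -(cfResE _ sHKG) ?def_chi; last by rewrite mem_gen // inE Hx orbT.
by rewrite -[x]mul1g cfDprodE // (lin_char1 lin_theta) mul1r cfResE // mul1g.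
Qed.

End LinearCharacters.

Section GeneratingCharacter.
Variable R : finPzRingType.
Local Notation gR := (R : finZmodType).

Lemma left_ideal_group_set (I : {set R}) : left_ideal I -> group_set (I : {set gR}).
Proof.
move=> IL; apply/group_setP; split=> [|x y]; first exact: left_ideal0.
exact: left_idealD.
Qed.

Lemma lin_charD (psi : 'CF([set: gR])) : psi \is a linear_char ->
  forall x y : R, psi (x + y) = psi x * psi y.
Proof. by move=> lin_psi x y; apply: (lin_charM lin_psi); rewrite inE. Qed.

Definition generating_on (c : R) (psi : 'CF([set: gR])) :=
  forall y, y \in principal c -> (forall r, psi (r * y) = 1) -> y = 0.

Lemma socle_generating_character (c : R) : c \in @left_socle R ->
  exists2 psi : 'CF([set: gR]), psi \is a linear_char & generating_on c psi.
Proof.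
have [n] := ubnP #|principal c|; elim: n c => // n IHn c lt_c cS.
have [->|c0] := eqVneq c 0.
  exists 1; first exact: cfun1_lin_char.
  by move=> _ /principalP[r ->] _; rewrite mulr0.
have [m [c' [e [def_c sm c'S dmc [em ec']]]]] := left_socle_split cS c0.
rewrite def_c in lt_c *.
have [|psi lin_psi gen_psi] := IHn c' _ c'S.
  exact: leq_trans (card_principal_split sm dmc em ec') _.
pose M := group (left_ideal_group_set (principal_left_ideal m)).
pose C := group (left_ideal_group_set (principal_left_ideal c')).
have psiD := lin_charD lin_psi.
have psi0 : psi 0 = 1 by apply: lin_char1 lin_psi.
have abM : abelian M by apply: FinRing.zmod_abelian.
have linM (i : Iirr M) : 'chi_i \is a linear_char by apply/char_abelianP.
(* Each bad character comes from some [y], which determines it; but [M] has [#|M|] characters, more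
   than there are such [y]. *)
have [i good_i] : exists i : Iirr M, forall y, y \in hom_elts m (principal c') ->
    ~ (forall r, 'chi_i (r * m) = psi (r * y)).
  pose good (i : Iirr M) := [forall y in hom_elts m (principal c'),
    ~~ [forall r, 'chi_i (r * m) == psi (r * y)]].
  have [i /forall_inP gi|bad] := pickP good.
    exists i => y /gi/negP Hy; move=> H; apply: Hy.
    by apply/forallP=> r; rewrite H.
  have {}bad (i : Iirr M) : exists y, (y \in hom_elts m (principal c'))
      && [forall r, 'chi_i (r * m) == psi (r * y)].
    have /negbT := bad i; rewrite negb_forall_in => /exists_inP[y Hy /negPn Hi].
    by exists y; rewrite Hy.
  pose f (i : Iirr M) := xchoose (bad i).
  have fP (i : Iirr M) : f i \in hom_elts m (principal c')
      /\ forall r, 'chi_i (r * m) = psi (r * f i).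
    have /andP[-> /forallP H] := xchooseP (bad i).
    by split=> // r; apply/eqP/H.
  have inj_f : injective f.
    move=> i j eq_f; apply: irr_inj; apply/cfun_inP=> _ /principalP[r ->].
    by have [[_ ->] [_ ->]] := (fP i, fP j); rewrite eq_f.
  have: (#|Iirr M| <= #|hom_elts m (principal c')|)%N.
    rewrite -(card_imset predT inj_f); apply/subset_leq_card/subsetP=> _ /imsetP[i _ ->].
    by case: (fP i).
  by rewrite (card_Iirr_abelian abM) leqNgt (card_hom_elts_split sm c'S em ec').
have tiMC : (M :&: C)%g = 1%g.
  apply/trivgP/subsetP=> x /setIP[/principalP[r ->] /principalP[s /dmc->]].
  exact: set11.
have [chi [lin_chi chiM chiC]] := glue_lin_char (FinRing.zmod_abelian _)
  (subsetT M) (subsetT C) tiMC (linM i) lin_psi.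
have chiE r s : chi (r * m + s * c') = 'chi_i (r * m) * psi (s * c').
  by rewrite (lin_charD lin_chi) chiM ?chiC //; apply: mem_principal.
exists chi => // _ /principalP[r ->] chi1.
have {}chi1 q : 'chi_i (q * r * m) * psi (q * r * c') = 1.
  by rewrite -chiE -mulrDr -mulrA chi1.
have [rm|rm0] := eqVneq (r * m) 0.
  rewrite mulrDr rm add0r; apply: gen_psi => [|q]; first exact: mem_principal.
  by have := chi1 q; rewrite -mulrA rm mulr0 (lin_char1 (linM i)) mul1r mulrA.
have [t def_m] := simple_elt_divr sm (mem_principal r m) rm0.
(* If [r * m] were nonzero, ['chi_i] along [m] would agree with [psi] along [y], and [m |-> y] would
   be a morphism because [psi] is generating on [c']; this contradicts the choice of [i]. *)
pose y := - (t * r * c').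
have chi_y q : 'chi_i (q * m) = psi (q * y).
  rewrite {1}def_m mulrA mulrA; have := chi1 (q * t) => chiqt.
  apply: (mulIf (x := psi (q * t * r * c'))).
    by apply: contra_eq_neq chiqt => ->; rewrite mulr0 eq_sym oner_eq0.
  by rewrite chiqt -psiD /y mulrN !mulrA addNr psi0.
case: (good_i y) => //; apply/hom_eltsP; split=> [|s sm0].
  by rewrite left_idealN ?principal_left_ideal ?mem_principal.
apply: gen_psi => [|q].
  by rewrite left_idealM ?left_idealN ?principal_left_ideal ?mem_principal.
by rewrite mulrA -chi_y -mulrA sm0 mulr0 (lin_char1 (linM i)).
Qed.

(** The image [z] of the class of 1 generates the socle, and every nonzero left ideal contains a
    minimal one, which lies in the socle. So a character generating on [z] is generating on 1. *)
Lemma frobenius_ring_character : frobenius_ring R ->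
  exists2 psi : 'CF([set: gR]), psi \is a linear_char & generating_on 1 psi.
Proof.
case=> _ [f [g _ gK]].
pose z0 := f (quot_pi _ (1 : R^o)); pose z : R := submodule_val z0.
have [psi lin_psi gen_psi] :=
  socle_generating_character (submodule_mem z0 : z \in @left_socle R).
exists psi => // x _ psi1; apply/eqP/negPn/negP=> x0.
have [L minL sLx] := exists_minimal_left_ideal (principal_left_ideal x) (principal_id x) x0.
have [y sy Ly] := minimal_left_ideal_simple minL.
have /principalP[q def_y] : y \in principal x by apply: (subsetP sLx); rewrite -Ly principal_id.
case/negP: (simple_elt_neq0 sy); apply/eqP/gen_psi => [|r]; last first.
  by rewrite def_y mulrA psi1.
pose w := Submodule (simple_elt_socle sy).
(* A lift of the preimage of [y], so that [y = r * z]. *)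
pose r : R := generic_quotient.repr (g w : Quotient.quot (submod_pred _)).
apply/principalP; exists r.
have -> : y = submodule_val (f (g w)) by rewrite gK.
rewrite -(quot_pi_surj (g w)) -/r -[r in quot_pi _ r]mulr1.
have -> : quot_pi (@jacobson_radical R) (r * 1 : R^o) = r *: quot_pi _ (1 : R^o).
  exact/esym/quot_scale_pi.
by rewrite linearZ.
Qed.

End GeneratingCharacter.

(** * The Frobenius functional *)

Section Fourier.
Variables (K : fieldType) (n : nat).
Hypothesis n_gt0 : (0 < n)%N.

Definition additive_mod (V : zmodType) (f : V -> nat) :=
  forall x y, f (x + y) = f x + f y %[mod n].

Section AdditiveMod.
Variables (V : zmodType) (f : V -> nat).
Hypothesis fD : additive_mod f.

Lemma additive_mod0 : f 0 = 0 %[mod n].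
Proof.
by apply/eqP; rewrite -(eqn_modDl (f 0)) addn0 -fD addr0.
Qed.

Lemma additive_modMn x k : f (x *+ k) = k * f x %[mod n].
Proof.
elim: k => [|k IHk]; first by rewrite mulr0n additive_mod0.
by rewrite mulrS fD mulSn -modnDmr IHk modnDmr.
Qed.
End AdditiveMod.

(* subgroup_kernel is the element prod_p ([0] - [- n/p]) of the group algebra of
   Z/n, the factors being taken in the p-primary components: a nontrivial
   subgroup contains some n/p, so that this factor makes the sum over the
   subgroup telescope to zero, although the value at 0 is 1. *)
Definition prime_indicator (p t : nat) : K :=
  (p ^ logn p n %| t)%:R - (p ^ logn p n %| t + n %/ p)%:R.

Definition subgroup_kernel t : K := \prod_(p <- primes n) prime_indicator p t.

Lemma prime_indicatorD p t d : (p ^ logn p n %| d)%N ->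
  prime_indicator p (t + d) = prime_indicator p t.
Proof. by move=> pd; rewrite /prime_indicator dvdn_addl // addnAC dvdn_addl. Qed.

Lemma pfactor_dvdn_div p q : prime p -> prime q -> p != q -> (q %| n)%N ->
  (p ^ logn p n %| n %/ q)%N.
Proof.
move=> p_pr q_pr pq qn; rewrite -(@Gauss_dvdr _ q); last first.
  by rewrite coprimeXl // prime_coprime // dvdn_prime2.
by rewrite mulnC divnK // pfactor_dvdnn.
Qed.

Lemma subgroup_kernelD t d : (n %| d)%N ->
  subgroup_kernel (t + d) = subgroup_kernel t.
Proof.
move=> nd; apply: eq_bigr => p _; rewrite prime_indicatorD //.
exact: dvdn_trans (pfactor_dvdnn _ _) nd.
Qed.

Lemma subgroup_kernel_mod t : subgroup_kernel (t %% n) = subgroup_kernel t.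
Proof. by rewrite [in RHS](divn_eq t n) addnC subgroup_kernelD // dvdn_mull. Qed.

Lemma subgroup_kernel0 : subgroup_kernel 0 = 1.
Proof.
rewrite /subgroup_kernel big_seq big1 // => p; rewrite mem_primes => /and3P[p_pr _ pn].
rewrite /prime_indicator dvdn0 add0n; case: (boolP (_ %| _)%N) => //; last by rewrite subr0.
move=> pd; have : (p ^ (logn p n).+1 %| n)%N.
  by rewrite expnS -[X in (_ %| X)%N](divnK pn) mulnC dvdn_mul.
by rewrite pfactor_dvdn // ltnn.
Qed.

(** In Z/n, [v] generates the same subgroup as [d = gcdn v n], a proper divisor of [n]. For a prime
    [p] dividing [n %/ d], the number [n %/ p] is a multiple of [d]; a Bezout coefficient gives
    [k]. *)
Lemma exists_multiple_div v : ~~ (n %| v)%N ->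
  exists k p, [/\ prime p, (p %| n)%N & k * v = n %/ p %[mod n]].
Proof.
move=> nv; have v_gt0 : (0 < v)%N by case: v nv; rewrite ?dvdn0.
case: (egcdnP n v_gt0) => k j kv _; set d := gcdn v n in kv.
have dn : (d %| n)%N by apply: dvdn_gcdr.
have nd_gt1 : (1 < n %/ d)%N.
  rewrite ltn_divRL // mul1n ltn_neqAle dvdn_leq // andbT.
  by apply: contraNneq nv => <-; apply: dvdn_gcdl.
have p_pr := pdiv_prime nd_gt1; have pnd := pdiv_dvd (n %/ d).
set p := pdiv _ in p_pr pnd.
exists (n %/ d %/ p * k)%N, p; split=> //.
  by apply: dvdn_trans pnd _; rewrite dvdn_div.
rewrite -mulnA kv mulnDr mulnA modnMDl; congr (_ %% _)%N.
by rewrite mulnC muln_divA // mulnC divnK.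
Qed.

Lemma sum_subgroup_kernel (V : finZmodType) (f : V -> nat) x :
  additive_mod f -> ~~ (n %| f x)%N -> \sum_y subgroup_kernel (f y) = 0.
Proof.
move=> fD /exists_multiple_div[k [p [p_pr pn kx]]].
have p_n : p \in primes n by rewrite mem_primes p_pr n_gt0.
pose G t := \prod_(q <- primes n | q != p) prime_indicator q t.
have GD t d : (n %/ p %| d)%N -> G (t + d)%N = G t.
  move=> pd; rewrite /G big_seq_cond [RHS]big_seq_cond; apply: eq_bigr => q.
  rewrite mem_primes => /andP[/and3P[q_pr _ _] qp]; rewrite prime_indicatorD //.
  by apply: dvdn_trans pd; apply: pfactor_dvdn_div.
pose F t := G t * (p ^ logn p n %| t)%:R.
have FD t d : (n %| d)%N -> F (t + d)%N = F t.
  move=> nd; rewrite /F GD; last by apply: dvdn_trans nd; apply: dvdn_div.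
  by rewrite dvdn_addl // (dvdn_trans (pfactor_dvdnn _ _) nd).
have Fmod t : F (t %% n)%N = F t by rewrite [in RHS](divn_eq t n) addnC FD // dvdn_mull.
(* The factors at the other primes, gathered in [G], are invariant under the shift by [n %/ p]. *)
have kernelE t : subgroup_kernel t = F t - F (t + n %/ p)%N.
  rewrite /subgroup_kernel (big_rem p p_n) /= /F GD // -mulrBr mulrC; congr (_ * _).
  by rewrite rem_filter ?primes_uniq // big_filter; apply: eq_bigl => q.
rewrite (eq_bigr _ (fun y _ => kernelE (f y))) sumrB; apply/eqP; rewrite subr_eq0; apply/eqP.
(* Adding [x *+ k] to [y] shifts [f y] by [n %/ p] modulo [n]. *)
rewrite (reindex_inj (addIr (x *+ k))) /=; apply: eq_bigr => y _.
by rewrite -Fmod fD -modnDmr additive_modMn // kx modnDmr Fmod.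
Qed.

End Fourier.

(** * Recovering coefficients from sums over fibers *)

Section Descent.
Variables (K : fieldType) (R : finPzRingType) (n : nat) (phi : R -> nat) (l : nat -> K).
Hypothesis n_gt0 : (0 < n)%N.
Hypothesis R_neq0 : #|R|%:R != 0 :> K.
Hypothesis phiD : additive_mod n phi.
Hypothesis phi_sep : forall x : R, x != 0 -> exists s : R, ~~ (n %| phi (s * x)%R)%N.
Hypothesis nd_l : nondegenerate_mod n l.

Lemma pullback_nondegenerate (a : R -> K) :
  (forall s, \sum_r a r * l (phi (s * r)) = 0) -> forall r, a r = 0.
Proof.
move=> al r0; have [l_mod l_nd] := nd_l.
have phi_mod s (g : nat -> K) : (forall t, g (t %% n)%N = g t) ->
    \sum_r a r * g (phi (s * r)) =
    \sum_(t < n) (\sum_(r | (phi (s * r)%R %% n)%N == t) a r) * g t.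
  move=> g_mod.
  rewrite (partition_big (fun r => Ordinal (ltn_pmod (phi (s * r)) n_gt0)) xpredT) //=.
  apply: eq_bigr => t _; rewrite mulr_suml; apply: eq_big => [r|r /eqP <-].
    by rewrite -val_eqE.
  by rewrite /= g_mod.
have fib s : forall t, (t < n)%N -> \sum_(r | (phi (s * r)%R %% n)%N == t) a r = 0.
  (* Replacing [s] by [s *+ k] multiplies the residues by [k], which supplies every row of the
     matrix of [l]. *)
  apply: l_nd => k; rewrite -[RHS](al (s *+ k)) -(phi_mod s (fun t => l (k * t)%N)) => [|t].
    apply: eq_bigr => r _; congr (_ * _); rewrite mulrnAl -l_mod -[RHS]l_mod.
    by rewrite (additive_modMn phiD).
  by rewrite -l_mod modnMmr l_mod.
pose h := subgroup_kernel K n.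
have h_mod t : h (t %% n)%N = h t by apply: subgroup_kernel_mod.
(* This sum is computed twice: each inner sum depends only on sums over fibers, while exchanging the
   order leaves [#|R|%:R * a r0]. *)
have : \sum_s \sum_r a r * h (phi (s * (r - r0))) = 0.
  apply: big1 => s _.
  rewrite (eq_bigr (fun r => a r * h (phi (s * r)%R + phi (s * - r0)%R)%N)) => [|r _].
    rewrite (phi_mod s (fun t => h (t + phi (s * - r0)%R)%N)) => [|t].
      by apply: big1 => t _; rewrite fib // mul0r.
    by rewrite -h_mod modnDml h_mod.
  by rewrite mulrDr -h_mod phiD h_mod.
rewrite exchange_big /= (bigD1 r0) //= [X in _ + X]big1 => [|r rr0].
  rewrite addr0 subrr (eq_bigr (fun=> a r0)) => [|s _].
    by rewrite sumr_const -mulr_natr => /eqP; rewrite mulf_eq0 (negPf R_neq0) orbF => /eqP.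
  by rewrite mulr0 -h_mod (additive_mod0 phiD) h_mod /h subgroup_kernel0 // mulr1.
(* For [r != r0], [s |-> phi (s * (r - r0))] is a nonzero morphism to Z/n, along which [h] sums to
   0. *)
have [|s phi_s] := phi_sep (x := r - r0); first by rewrite subr_eq0.
rewrite -mulr_sumr (@sum_subgroup_kernel K n n_gt0 R (fun s => phi (s * (r - r0))) s) ?mulr0 //.
by move=> x y; rewrite mulrDl phiD.
Qed.

End Descent.

(** A square matrix with trivial kernel is invertible on both sides; this gives nondegeneracy in the
    other argument of the form. *)
Lemma tr_nondegenerate (K : fieldType) (T : finType) (F : T -> T -> K) :
    (forall a : T -> K, (forall s, \sum_r a r * F s r = 0) -> forall r, a r = 0) ->
  forall a : T -> K, (forall r, \sum_s a s * F s r = 0) -> forall s, a s = 0.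
Proof.
move=> nd a aF s.
pose M := \matrix_(i, j) F (enum_val i) (enum_val j) : 'M[K]_#|T|.
have M_free : row_free M^T.
  rewrite -kermx_eq0; apply/eqP/row_matrixP=> i; rewrite row0; set v := row i _.
  have vM : v *m M^T = 0 by rewrite -row_mul mulmx_ker row0.
  apply/rowP=> j; rewrite [RHS]mxE -[j]enum_valK.
  apply: (nd (fun r => v 0 (enum_rank r))) => u.
  transitivity ((v *m M^T) 0 (enum_rank u)); last by rewrite vM mxE.
  rewrite [RHS]mxE (reindex (@enum_val T T)) /=; last exact: (onW_bij _ (enum_val_bij T)).
  by apply: eq_bigr => r _; rewrite [M^T _ _]mxE [M _ _]mxE enum_valK enum_rankK.
have M_unit : M \in unitmx by rewrite -unitmx_tr -row_free_unit.
pose v := \row_j a (enum_val j) : 'rV[K]_#|T|.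
have /(congr1 (mulmx^~ (invmx M))) : v *m M = 0.
  apply/rowP=> j; rewrite !mxE -[RHS](aF (enum_val j)).
  rewrite (reindex (@enum_val T T)) /=; last exact: (onW_bij _ (enum_val_bij T)).
  by apply: eq_bigr => r _; rewrite !mxE.
rewrite mulmxK // mul0mx => /rowP/(_ (enum_rank s)).
by rewrite !mxE enum_rankK.
Qed.

(** * The characteristic and the order of a finite ring *)

Section RingCharacteristic.
Variable R : finPzRingType.

Lemma ring_characteristic_gt0 : (0 < ring_characteristic R)%N.
Proof. exact: order_gt0. Qed.

Lemma mulrn_ring_characteristic (x : R) : x *+ ring_characteristic R = 0.
Proof.
have n1 : (1 : R) *+ ring_characteristic R = 0 := expg_order (1%R : (R : finZmodType)).
by rewrite -[x]mulr1 -mulrnAr n1 mulr0.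
Qed.

(** Here [phi] is a discrete logarithm of a generating character, whose values are roots of unity
    because the characteristic kills [R]. *)
Lemma frobenius_ring_residue_form : frobenius_ring R ->
  exists2 phi : R -> nat, additive_mod (ring_characteristic R) phi &
    forall x : R, x != 0 -> exists s, ~~ (ring_characteristic R %| phi (s * x)%R)%N.
Proof.
move=> /frobenius_ring_character[psi lin_psi gen_psi].
have [w w_prim] := C_prim_root_exists ring_characteristic_gt0.
have psiX x : psi x ^+ ring_characteristic R = 1.
  rewrite -(lin_charX lin_psi) ?inE // -[(x ^+ _)%g]/(x *+ _).
  by rewrite mulrn_ring_characteristic; apply: lin_char1 lin_psi.
pose phi x : nat := sval (prim_rootP w_prim (psiX x)).
have psiE x : psi x = w ^+ phi x by rewrite /phi; case: prim_rootP.
exists phi => [x y|x x0].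
  apply/eqP; rewrite -(eq_prim_root_expr w_prim) exprD -!psiE.
  by rewrite (lin_charD lin_psi).
apply/existsP; apply: contraNT x0 => /existsPn phi0.
apply/eqP/gen_psi => [|s]; first by rewrite -[x]mulr1 mem_principal.
by rewrite psiE; apply/eqP; rewrite -(prim_order_dvd w_prim) -[(_ %| _)%N]negbK.
Qed.

(** By Cauchy's theorem, a prime dividing [#|R|] is the additive order of an element, hence divides
    the characteristic. *)
Lemma natr_card_neq0 (K : fieldType) :
    (forall p, p \in [pchar K] -> ~~ (p %| ring_characteristic R)%N) ->
  #|R|%:R != 0 :> K.
Proof.
move=> hK; have R_gt0 : (0 < #|R|)%N by apply/card_gt0P; exists 0.
apply/negP=> R0; have [p p_char] := natf0_pchar R_gt0 R0.
have := hK p p_char; rewrite -(dvdn_pcharf p_char) -cardsT in R0 *.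
have [x _ <-] := @Cauchy _ p [set: (R : finZmodType)] (pcharf_prime p_char) R0.
by rewrite order_dvdn -[(x ^+ _)%g]/(x *+ _) mulrn_ring_characteristic eqxx.
Qed.

Lemma natr_ring_characteristic_neq0 (K : fieldType) :
    (forall p, p \in [pchar K] -> ~~ (p %| ring_characteristic R)%N) ->
  (ring_characteristic R)%:R != 0 :> K.
Proof.
move=> hK; apply/negP=> n0.
have [p p_char] := natf0_pchar ring_characteristic_gt0 n0.
by have := hK p p_char; rewrite (dvdn_pcharf p_char) n0.
Qed.

End RingCharacteristic.

(** * Linear functionals on a monoid algebra *)

Section MonoidAlgebraForms.
Variables (K : fieldType) (M : finType) (e : M) (op : Monoid.law e) (f : M -> K).

Definition linear_extension (u : monoid_algebra K op) : K := \sum_m u m * f m.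

Fact linear_extension_is_linear : scalar linear_extension.
Proof.
move=> a u v; rewrite /linear_extension mulr_sumr -big_split.
by apply: eq_bigr => m _; rewrite !ffunE mulrDl -mulrA.
Qed.

HB.instance Definition _ :=
  GRing.isLinear.Build K (monoid_algebra K op) K *%R linear_extension
    linear_extension_is_linear.

Lemma linear_extension_basis m : linear_extension (monoid_basis K op m) = f m.
Proof.
rewrite /linear_extension (bigD1 m) //= big1 => [|x /negPf xm]; rewrite ffunE.
  by rewrite eqxx mul1r addr0.
by rewrite xm mul0r.
Qed.

Lemma linear_extension_mulr_basis (u : monoid_algebra K op) n :
  linear_extension (u * monoid_basis K op n) = \sum_m u m * f (op m n).
Proof.
rewrite {1}(monoid_algebra_decomp u) mulr_suml linear_sum; apply: eq_bigr => m _.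
by rewrite -scalerAl linearZ /= [monoid_basis _ _ _ * _]monoid_basis_mul linear_extension_basis.
Qed.

Lemma linear_extension_mull_basis (u : monoid_algebra K op) n :
  linear_extension (monoid_basis K op n * u) = \sum_m u m * f (op n m).
Proof.
rewrite {1}(monoid_algebra_decomp u) mulr_sumr linear_sum; apply: eq_bigr => m _.
by rewrite -scalerAr linearZ /= [monoid_basis _ _ _ * _]monoid_basis_mul linear_extension_basis.
Qed.

Lemma frobenius_monoid_algebra :
    (forall a : M -> K, (forall m, \sum_n a n * f (op m n) = 0) -> forall n, a n = 0) ->
  frobenius_algebra (monoid_algebra K op).
Proof.
move=> nd; exists linear_extension; split=> u u0; apply/ffunP=> m; rewrite ffunE.
  apply: (tr_nondegenerate nd (a := u)) => n.
  by rewrite -linear_extension_mulr_basis; apply: u0.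
apply: (nd u) => n.
by rewrite -linear_extension_mull_basis; apply: u0.
Qed.

End MonoidAlgebraForms.

Theorem theorem4p3 (R : finPzRingType) (K : fieldType)
    (hR : frobenius_ring R)
    (hK : forall p : nat, p \in [pchar K] -> ~~ (p %| ring_characteristic R)%N) :
  frobenius_algebra (monoid_algebra K (@GRing.mul R)).
Proof.
have [phi phiD phi_sep] := frobenius_ring_residue_form hR.
have [l nd_l] := exists_nondegenerate_mod (natr_ring_characteristic_neq0 hK).
(* The matrix of the resulting form in the basis [R] is [l (phi (s * r))]. *)
apply: (@frobenius_monoid_algebra _ _ _ _ (fun r => l (phi r))).
apply: pullback_nondegenerate nd_l => //; first exact: ring_characteristic_gt0.
exact: natr_card_neq0.
Qed.
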